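(* Let $r$ be a positive integer and let $w$ be a finite word over $\{0,1\}$. If $\widetilde w$ is the word obtained by reversing the order of the bits of $w$, then $R_{1,1}(w,r)=R_{1,1}(\widetilde w,r)$ in $\mathbb{Z}[X,Y]$.
   Context: Given a finite word $w$ over $\{0,1\}$, extend it to a doubly infinite bit sequence $s:\mathbb{Z}\to\{0,1\}$ by adding infinitely many bits $1$ on its left and infinitely many bits $1$ on its right. A placement of $n$ $r$-ribbons (below the lattice path described by $s$: a unit step right for each bit $0$ and up for each bit $1$, read from left to right) is a sequence of positions $i_1<i_2<\cdots<i_n$ in $\mathbb{Z}$ such that one can successively, for $t=1,2,\dots,n$, perform the following change: the current bit sequence $s^{(t-1)}$ (with $s^{(0)}=s$) satisfies $s^{(t-1)}_{i_t-r}=1$ and $s^{(t-1)}_{i_t}=0$, and $s^{(t)}$ is obtained from it by setting the bit at $i_t-r$ to $0$ and the bit at $i_t$ to $1$. The height of the $t$-th ribbon is $\sum_{j=1}^{r-1}s^{(t-1)}_{i_t-j}$, and the total height of the placement is the sum of the heights of its $n$ ribbons. Then $$R_{1,1}(w,r)=\sum X^nY^{h},$$ the sum being over all placements of $r$-ribbons (all $n\ge0$, including the empty placement), where $n$ is the number of ribbons and $h$ the total height of the placement. (This is a polynomial.) *)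

(* Defs.v *)
From mathcomp Require Import all_boot all_order all_algebra.
From mathcomp Require Import boolp classical_sets functions cardinality fsbigop.

Set Implicit Arguments.
Unset Strict Implicit.
Unset Printing Implicit Defensive.

Import Order.TTheory GRing.Theory Num.Theory.
Local Open Scope ring_scope.

(* Bits are booleans (false is 0, true is 1). The word [w] occupies the
   positions 0, ..., size w - 1; every other bit is 1. *)
Definition bits (w : seq bool) (i : int) : bool :=
  match i with
  | Posz n => nth true w n
  | Negz _ => true
  end.

Definition add_ribbon (r : nat) (s : int -> bool) (i : int) : int -> bool :=
  fun j => if j == i - r%:Z then false else if j == i then true else s j.

Definition ribbon_height (r : nat) (s : int -> bool) (i : int) : nat :=
  (\sum_(1 <= j < r) s (i - j%:Z)%R)%N.

Fixpoint can_add_ribbons (r : nat) (s : int -> bool) (p : seq int) : bool :=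
  if p is i :: p' then
    [&& s (i - r%:Z), ~~ s i & can_add_ribbons r (add_ribbon r s i) p']
  else true.

Fixpoint total_height (r : nat) (s : int -> bool) (p : seq int) : nat :=
  if p is i :: p' then
    (ribbon_height r s i + total_height r (add_ribbon r s i) p')%N
  else 0%N.

Definition placements (r : nat) (w : seq bool) : set (seq int) :=
  [set p | sorted <%R p && can_add_ribbons r (bits w) p]%classic.

Lemma can_add_ribbons_bit (r : nat) (s : int -> bool) (p : seq int) (x : int) :
  sorted <%R p -> can_add_ribbons r s p -> x \in p -> ~~ s x.
Proof.
elim: p s => [//|i p IHp] s /= pp /and3P[_ si cp].
rewrite inE => /predU1P[->//|xp].
have lt_ix : i < x by move/allP: (order_path_min lt_trans pp) => /(_ x xp).
have := IHp _ (path_sorted pp) cp xp.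
rewrite /add_ribbon (gt_eqF lt_ix) gt_eqF //.
by apply: le_lt_trans lt_ix; rewrite gerBl.
Qed.

(* The finitely supported sum below is thus a genuine sum over all placements
   (it would be 0 by convention if its support were infinite). *)
Lemma finite_placements (r : nat) (w : seq bool) :
  finite_set (placements r w).
Proof.
pose L := [seq n%:Z | n <- iota 0 (size w)].
apply: (@sub_finite_set _ _
  ((fun m : (size w).-tuple bool => mask m L) @` setT)%classic); last first.
  exact/finite_image/finite_finset.
move=> p /andP[sp cp] /=.
have pL : {subset p <= L}.
  move=> x xp; have := can_add_ribbons_bit sp cp xp.
  case: x {xp} => [n|//] /= wn; apply: map_f; rewrite mem_iota /= add0n.
  by rewrite ltnNge; apply: contra wn => /(nth_default true) ->.
have sL : sorted <%R L.
  by rewrite sorted_map; apply: sub_sorted (iota_ltn_sorted 0 (size w)).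
have -> : p = [seq x <- L | x \in p].
  apply: (irr_sorted_eq lt_trans ltxx) => //.
    exact: (sorted_filter lt_trans).
  move=> x; rewrite mem_filter; apply/idP/andP => [xp|[]//].
  by split=> //; exact: pL.
have /subseqP[m szm ->] := filter_subseq [in p] L.
have szm' : size m == size w by rewrite szm size_map size_iota.
by exists (Tuple szm').
Qed.

(* Z[X,Y] is represented as Z[Y][X]: the outer indeterminate ['X] is X and the
   constant polynomial ['X%:P] is Y. *)
Definition ribbon_poly (w : seq bool) (r : nat) : {poly {poly int}} :=
  \sum_(p \in placements r w)
    ('X ^+ size p * 'X%:P ^+ total_height r (bits w) p : {poly {poly int}}).

(* Main.v *)
Require Import Defs.
From mathcomp Require Import all_boot all_order all_algebra.
From mathcomp Require Import boolp fsbigop.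
From mathcomp Require Import zify ring.

Set Implicit Arguments.
Unset Strict Implicit.
Unset Printing Implicit Defensive.

Import Order.TTheory GRing.Theory Num.Theory.
Local Open Scope ring_scope.

(** Scanning the word from left to right, only the current values of the last
    r bits matter, so R(w) = eps (A_{w_n} ... A_{w_1} 1^r), where the transfer
    operators A_0 and A_1 act on the free module on windows of r bits and eps
    sums the coefficients.  The theorem holds because A_0 and A_1 are
    self-adjoint for a bilinear form < , > on that module which satisfies
    < 1^r, v > = < v, 1^r > = eps v: then R(w) = < A_w 1^r, 1^r > and moving the
    operators to the other side reverses w.

    The value < v, k > is forced by these requirements.  The window v ends just
    before k read backwards starts, so the bits at distance r form r pairs (b, c),
    and [pairing] evaluates the resulting list of pairs. *)

(* The list starts with the pair farthest to the right.  The form itself is the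
   value at s = t = x and z = 1; the parameters s, t and z absorb the influence
   of the pairs already removed, so that identities can be proved by induction. *)
Fixpoint pairing (R : comNzRingType) (y : R) (L : seq (bool * bool)) (s t z : R)
    : R :=
  if L is (b, c) :: L' then
    let P := pairing y L' (s * y ^+ b) (t * y ^+ c) in
    if c then z * P z
    else (1 - z * t * y ^+ size L') * P z + z * s * P (z * y) *+ b
  else 1.

(** Homogeneity: z occurs in the products [z * s] and [z * t], and otherwise once for each pair with
    c = 1. *)
Lemma pairing_scale (R : comNzRingType) (y : R) L (s t z l : R) :
  pairing y L (l * s) (l * t) z * l ^+ count snd L = pairing y L s t (l * z).
Proof.
elim: L s t z => [|[b c] L IH] s t z /=; first by rewrite mulr1.
have E u : pairing y L (s * y ^+ b) (t * y ^+ c) (l * u) =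
    pairing y L (l * s * y ^+ b) (l * t * y ^+ c) u * l ^+ count snd L.
  by rewrite -!(mulrA l) IH.
rewrite -(mulrA l z y) !E.
by case: c b {E} => [] [] /=; rewrite ?exprS ?mulr1n ?mulr0n; ring.
Qed.

(** For [s = t] the head rule at (1, 0) is this right-hand side with [s * y] in place of s, so the
    effect of dropping a head (1, c) does not depend on c. *)
Lemma pairing_shift (R : comNzRingType) (y : R) L (s t z : R) :
  pairing y L s (t * y) z = (1 - t * z * y ^+ size L) * pairing y L s t z
                            + t * z * pairing y L s t (z * y).
Proof.
elim: L s t z => [|[b c] L IH] s t z /=; first by ring.
case: c => /=; first by rewrite !expr1 IH exprS; ring.
rewrite !expr0 !mulr1 !IH exprS.
by case: b => /=; rewrite ?mulr1n ?mulr0n; ring.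
Qed.

(** The recursion from the other end of the list, where a transfer of the second window acts. *)
Lemma pairing_rcons (R : comNzRingType) (y : R) L b c (s t z : R) :
  pairing y (rcons L (b, c)) s t z =
  if c then z * pairing y L (s * y) (t * y) z
  else pairing y L s (t * y) z
       + z * ((s * y ^+ count fst L) *+ b - t * y ^+ count snd L)
         * pairing y L (s * y) (t * y) z.
Proof.
elim: L s t z => [|[b' c'] L IH] s t z /=.
  by case: c b => [] [] /=; rewrite ?mulr1n ?mulr0n; ring.
have e1 (u v : R) : u * y * v = u * v * y by ring.
rewrite size_rcons !IH !(e1 _ (y ^+ _)).
by case: c b c' b' {IH} => [] [] [] [] /=;
  rewrite ?expr0 ?expr1 ?mulr1 ?add0n ?add1n ?exprS ?mulr1n ?mulr0n; ring.
Qed.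

Lemma pairing_last1 (R : comNzRingType) (x y : R) L c :
  pairing y ((true, c) :: L) x x 1 = pairing y L (x * y) (x * y) 1.
Proof.
by case: c => /=; rewrite ?expr1 ?expr0 ?mulr1 ?pairing_shift !mul1r ?mulr1.
Qed.

(** The right-hand side is what [pairing_rcons] gives for (0, 0): this pair may move from the head
    to the end. *)
Lemma pairing_last00 (R : comNzRingType) (x y : R) L :
  pairing y ((false, false) :: L) x x 1 =
  pairing y L x (x * y) 1
  - x * y ^+ count snd L * pairing y L (x * y) (x * y) 1.
Proof.
have := pairing_scale y L x x 1 y.
rewrite ![y * x]mulrC mulr1 => E.
by rewrite /= !(expr0, mulr1, mul1r, mulr0n, addr0) pairing_shift
  !(mulr1, mul1r) -E; ring.
Qed.

Lemma pairing_all_snd (R : comNzRingType) (y : R) L (s t : R) :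
  all snd L -> pairing y L s t 1 = 1.
Proof. by elim: L s t => //= -[b []] L IH s t //= /IH->; rewrite mulr1. Qed.

(* Removing (1, c) from the head has the same effect as appending (1, 1) at the
   end of the list and removing it there; so L rotates into a list of (1, 1). *)
Lemma pairing_all_fst (R : comNzRingType) (x y : R) L :
  all fst L -> pairing y L x x 1 = 1.
Proof.
rewrite -[L in pairing _ L](cats0 L) -[[::]]/(nseq 0 (true, true)).
elim: L 0%N => [|[b c] L IH] j /=.
  by rewrite pairing_all_snd // all_nseq orbT.
case: b => //= /(IH j.+1) IHj.
rewrite -[LHS]/(pairing y ((true, c) :: _) x x 1) pairing_last1 -[RHS]IHj.
by rewrite -addn1 nseqD catA cats1 pairing_rcons mul1r.
Qed.

(* A window lists its bits from the most recently read one to the oldest one, and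
   [transfer x y a v f] is the linear extension of f evaluated at A_a v. *)
Definition transfer (R : comNzRingType) (x y : R) (a : bool) (v : seq bool)
    (f : seq bool -> R) : R :=
  let d := take (size v).-1 v in
  f (a :: d) + x * y ^+ count id d * f (true :: d) *+ (last true v && ~~ a).

Fixpoint word_sum (R : comNzRingType) (x y : R) (f : seq bool -> R)
    (v w : seq bool) : R :=
  if w is a :: w' then transfer x y a v (fun v' => word_sum x y f v' w')
  else f v.

Definition form (R : comNzRingType) (x y : R) (v k : seq bool) : R :=
  pairing y (zip v (rev k)) x x 1.

Lemma transfer_rcons (R : comNzRingType) (x y : R) a d b f :
  transfer x y a (rcons d b) f =
  f (a :: d) + x * y ^+ count id d * f (true :: d) *+ (b && ~~ a).
Proof.
by rewrite /transfer size_rcons last_rcons -cats1 take_size_cat.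
Qed.

(** Both sides reduce to the pairs of [zip d (rev e)]: a transfer of v gives them a new head, a
    transfer of k a new last pair. *)
Lemma form_transfer (R : comNzRingType) (x y : R) a v k :
    size v = size k -> (0 < size v)%N ->
  transfer x y a v (fun v' => form x y v' k) = transfer x y a k (form x y v).
Proof.
case/lastP: v => // d b; case/lastP: k => [|e c]; rewrite !size_rcons // => -[sz] _.
rewrite !transfer_rcons /form rev_rcons !rev_cons !zip_rcons ?size_rev //.
rewrite ![zip (_ :: _) _]/=.
have cd : count id d = count fst (zip d (rev e)).
  by rewrite -(count_map fst id) -/unzip1 unzip1_zip // size_rev sz.
have ce : count id e = count snd (zip d (rev e)).
  by rewrite -(count_map snd id) -/unzip2 unzip2_zip ?count_rev // size_rev sz.
rewrite cd ce !pairing_rcons !pairing_last1.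
case: a c b => [] [] []; rewrite ?pairing_last1 ?pairing_last00 /=;
  by rewrite ?expr0 ?expr1 ?mulr1n ?mulr0n ?mulr1; ring.
Qed.

Lemma word_sum_cat (R : comNzRingType) (x y : R) f v w1 w2 :
  word_sum x y f v (w1 ++ w2) = word_sum x y (fun v' => word_sum x y f v' w2) v w1.
Proof. by elim: w1 v => //= a w1 IH v; rewrite /transfer !IH. Qed.

Lemma word_sum_linear (R : comNzRingType) (x y c : R) f g v w :
  word_sum x y (fun v' => f v' + c * g v') v w =
  word_sum x y f v w + c * word_sum x y g v w.
Proof.
elim: w v => //= a w IH v; rewrite /transfer !IH.
by case: (_ && _); rewrite ?mulr1n ?mulr0n; ring.
Qed.

Lemma eq_word_sum (R : comNzRingType) (x y : R) f g n v w :
    (forall u, size u = n.+1 -> f u = g u) -> size v = n.+1 ->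
  word_sum x y f v w = word_sum x y g v w.
Proof.
move=> fg; elim: w v => [|a w IH] v sv /=; first exact: fg.
by rewrite /transfer !IH //= size_take sv ltnSn.
Qed.

Lemma word_sum_form_rev (R : comNzRingType) (x y : R) n v k w :
    size v = n.+1 -> size k = n.+1 ->
  word_sum x y (fun v' => form x y v' k) v w = word_sum x y (form x y v) k (rev w).
Proof.
elim: w v => //= a w IH v sv sk.
have sd b : size (b :: take (size v).-1 v) = n.+1 by rewrite /= size_take sv ltnSn.
rewrite rev_cons -cats1 word_sum_cat /transfer !IH //.
(* Linearity brings the transfer of v inside the sum over [rev w], where [form_transfer] moves it to
   u. *)
rewrite -mulrnAl -word_sum_linear; apply: eq_word_sum sk => u su /=.
by rewrite -form_transfer ?sv // /transfer sv mulrnAl.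
Qed.

Lemma word_sum_rev (R : comNzRingType) (x y : R) n w :
  word_sum x y (fun=> 1) (nseq n.+1 true) w =
  word_sum x y (fun=> 1) (nseq n.+1 true) (rev w).
Proof.
set o := nseq _ _; have so : size o = n.+1 by rewrite size_nseq.
have all_o : all id o by rewrite all_nseq orbT.
transitivity (word_sum x y (fun v => form x y v o) o w).
  apply: eq_word_sum (so) => u su; rewrite /form pairing_all_snd //.
  by rewrite -(all_map snd id) -/unzip2 unzip2_zip ?all_rev // size_rev su so.
rewrite (word_sum_form_rev _ _ _ so so); apply: eq_word_sum (so) => u su.
rewrite /form pairing_all_fst // -(all_map fst id) -/unzip1 unzip1_zip //.
by rewrite size_rev su so.
Qed.

Fixpoint enum_placements (r m : nat) (s : int -> bool) (k : int)
    : seq (seq int) :=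
  if m is m'.+1 then
    enum_placements r m' s (k + 1) ++
    (if s (k - r%:Z) && ~~ s k then
       [seq k :: p | p <- enum_placements r m' (add_ribbon r s k) (k + 1)]
     else [::])
  else [:: [::]].

Lemma add_ribbon_ones r (s : int -> bool) (k l : int) :
  k < l -> (forall i, l <= i -> s i) -> forall i, l <= i -> add_ribbon r s k i.
Proof.
move=> kl sl i li; rewrite /add_ribbon sl // if_same; case: eqP => // ?; lia.
Qed.

(** The path condition makes p increase from k or later; no ribbon can sit at [k + m] or beyond,
    where all bits are 1. *)
Lemma mem_enum_placements r m (s : int -> bool) (k : int) p :
    (forall i, k + m%:Z <= i -> s i) ->
  (p \in enum_placements r m s k) =
  path <%R (k - 1) p && can_add_ribbons r s p.
Proof.
elim: m s k p => [|m IH] s k p sk /=.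
  rewrite inE; case: p => //= i p; case: (ltrP (k - 1) i) => //= ki.
  by rewrite (sk i) ?andbF //; lia.
have sk1 i : k + 1 + m%:Z <= i -> s i by move=> ?; apply: sk; lia.
have ak1 : forall i, k + 1 + m%:Z <= i -> add_ribbon r s k i.
  by apply: add_ribbon_ones sk1; lia.
rewrite mem_cat IH // addrK; case: p => [|i p] //=.
have -> : (i :: p \in (if s (k - r%:Z) && ~~ s k then
    [seq k :: p | p <- enum_placements r m (add_ribbon r s k) (k + 1)]
    else [::])) = [&& i == k, s (k - r%:Z), ~~ s k
      & p \in enum_placements r m (add_ribbon r s k) (k + 1)].
  case: (s (k - _)); case: (s k) => /=; rewrite ?andbF ?in_nil //.
  apply/mapP/andP => [[q pq [-> ->]]//|[/eqP-> pq]]; by exists p.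
case: eqVneq => [->|ik] /=.
  rewrite ltxx /= ltrBlDr ltrDl ltr01 /= IH // addrK.
  by rewrite !andbA; case: (path _ _ _); rewrite ?andbT ?andbF.
by rewrite orbF; have -> : (k - 1 < i) = (k < i) by lia.
Qed.

Lemma uniq_enum_placements r m (s : int -> bool) (k : int) :
  (forall i, k + m%:Z <= i -> s i) -> uniq (enum_placements r m s k).
Proof.
elim: m s k => [|m IH] s k sk //=.
have sk1 i : k + 1 + m%:Z <= i -> s i by move=> ?; apply: sk; lia.
rewrite cat_uniq IH //=; case: ifP => //= _; apply/andP; split.
  apply/hasPn => _ /mapP[p _ ->].
  by rewrite mem_enum_placements //= addrK ltxx.
by rewrite map_inj_uniq ?IH //; [apply: add_ribbon_ones sk1; lia | move=> ? ? []].
Qed.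

Lemma mkseq_cons (T : Type) (f : nat -> T) n :
  mkseq f n.+1 = f 0%N :: mkseq (fun j => f j.+1) n.
Proof. by rewrite /mkseq /= (iotaDl 1 0 n) -map_comp. Qed.

(** With r = [n.+1], a ribbon at k changes only the bits k - r and k: the first leaves the window in
    this step and the second enters it as 1, so the unread bits stay as they were. *)
Lemma sum_enum_placements (R : comNzRingType) (x y : R) n m (s : int -> bool) (k : int) :
  \sum_(p <- enum_placements n.+1 m s k)
     x ^+ size p * y ^+ total_height n.+1 s p =
  word_sum x y (fun=> 1) (mkseq (fun j => s (k - j.+1%:Z)) n.+1)
    (mkseq (fun j => s (k + j%:Z)) m).
Proof.
elim: m s k => [|m IH] s k; first by rewrite big_seq1 mulr1.
rewrite [mkseq _ m.+1]mkseq_cons [RHS]/= mkseqS transfer_rcons [LHS]/= big_cat IH.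
have eqw (s' : int -> bool) : (forall i, k < i -> s' i = s i) ->
    mkseq (fun j => s' (k + 1 + j%:Z)) m = mkseq (fun j => s (k + j.+1%:Z)) m.
  by move=> E; apply: eq_mkseq => j; rewrite E; [congr s|]; lia.
have eqv (s' : int -> bool) : (forall i, k - n.+1%:Z < i < k -> s' i = s i) ->
    mkseq (fun j => s' (k + 1 - j.+1%:Z)) n.+1
    = s' k :: mkseq (fun j => s (k - j.+1%:Z)) n.
  move=> E; rewrite mkseq_cons; congr (s' _ :: _); first lia.
  apply/eq_in_map => j; rewrite mem_iota => jn.
  by rewrite -E; [congr s'|]; lia.
rewrite eqw // eqv // addr0; congr (_ + _).
case: ifP => _; rewrite ?big_nil ?mulr0n // big_map.
under eq_bigr do rewrite /= exprS exprD mulrACA.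
rewrite -big_distrr IH eqw ?eqv; last 2 first.
- by move=> i ik; rewrite /add_ribbon !ifF //; lia.
- by move=> i ik; rewrite /add_ribbon !ifF //; lia.
rewrite mulr1n; congr (_ * _ ^+ _ * word_sum _ _ _ (_ :: _) _).
  rewrite /ribbon_height big_add1 /= big_mkord -sumn_count -map_comp.
  by rewrite sumnE big_map -[in RHS](subn0 n) big_mkord.
by rewrite /add_ribbon eqxx ifF //; lia.
Qed.

Lemma ribbon_poly_word_sum w n :
  ribbon_poly w n.+1 =
  word_sum 'X ('X%:P : {poly {poly int}}) (fun=> 1) (nseq n.+1 true) w.
Proof.
have w1 i : 0 + (size w)%:Z <= i -> bits w i.
  by case: i => //= i wi; rewrite nth_default //; lia.
have Ev : mkseq (fun j => bits w (0 - j.+1%:Z)) n.+1 = nseq n.+1 true.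
  rewrite -[RHS](mkseq_nth true) size_nseq; apply: eq_mkseq => j.
  by rewrite nth_nseq if_same sub0r -NegzE.
have Ew : mkseq (fun j => bits w (0 + j%:Z)) (size w) = w.
  by rewrite -[RHS](mkseq_nth true); apply: eq_mkseq => j; rewrite add0r.
rewrite -[in RHS]Ew -Ev -sum_enum_placements.
rewrite (fsbig_seq _ _ (uniq_enum_placements _ w1)) /ribbon_poly.
congr (\sum_(p \in _) _); apply/predeqP => -[|i p] /=.
  by rewrite mem_enum_placements.
(* A first ribbon at a negative position is impossible, the bit there being 1, so enumerating from 0
   misses no placement. *)
by rewrite mem_enum_placements // /placements /=; case: i => [i|i] /=; rewrite ?andbF.
Qed.

Theorem claim1p1p1 (r : nat) (hr : (0 < r)%N) (w : seq bool) :
  ribbon_poly w r = ribbon_poly (rev w) r.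
Proof.
by case: r hr => // n _; rewrite !ribbon_poly_word_sum word_sum_rev.
Qed.
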